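(* Let $n$ be a positive odd integer. Then any set of mutually unbiased complex Hadamard matrices of order $2n$ (that is, any set of complex Hadamard matrices of order $2n$ in which every two distinct members are unbiased) has at most $2$ elements.
   Context: A complex Hadamard matrix of order $m$ is an $m\times m$ matrix with all entries in $\{1,-1,i,-i\}$ whose rows are pairwise orthogonal in the usual complex inner product on $\mathbb{C}^m$ (so $HH^*=mI$, where $H^*$ is the Hermitian transpose). Two complex Hadamard matrices $H,K$ of order $2n$ are called unbiased if every entry of $HK^*$ has absolute value $\sqrt{2n}$. *)

(* Defs.v *)
From HB Require Import structures.
From mathcomp Require Import all_boot all_order all_algebra.
From mathcomp Require Import complex.
From mathcomp Require Import boolp classical_sets functions cardinality reals.

Set Implicit Arguments.
Unset Strict Implicit.
Unset Printing Implicit Defensive.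

Import Order.TTheory GRing.Theory Num.Theory.
Local Open Scope ring_scope.
Local Open Scope sesquilinear_scope.
Local Open Scope classical_set_scope.

Definition complex_hadamard (C : numClosedFieldType) (m : nat)
    (H : 'M[C]_m) : Prop :=
  (forall i j : 'I_m, H i j \in [:: 1; -1; 'i; - 'i]) /\
  (forall i j : 'I_m, i != j -> dotmx (row i H) (row j H) = 0).

Lemma complex_hadamard_mulmx (C : numClosedFieldType) (m : nat)
    (H : 'M[C]_m) : complex_hadamard H -> H *m H ^t* = m%:R%:M.
Proof.
move=> [Hent Hort]; apply/matrixP => i j; rewrite [RHS]mxE.
case: eqVneq => [<-|neq_ij]; last first.
  rewrite mulr0n -(Hort i j neq_ij) dotmxE !mxE.
  by apply: eq_bigr => k _; rewrite !mxE.
rewrite mulr1n mxE (eq_bigr (fun=> 1)) ?sumr_const ?card_ord // => k _.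
rewrite !mxE -normCK.
by move: (Hent i k); rewrite !inE => /or4P[] /eqP ->;
  rewrite ?normrN ?normCi ?normr1 ?expr1n.
Qed.

Definition unbiased (C : numClosedFieldType) (m : nat) (H K : 'M[C]_m) : Prop :=
  forall i j : 'I_m, `|(H *m K ^t*) i j| = sqrtC m%:R.

Definition mutually_unbiased_hadamard (C : numClosedFieldType) (m : nat)
    (S : set 'M[C]_m) : Prop :=
  (forall H, S H -> complex_hadamard H) /\
  (forall H K, S H -> S K -> H <> K -> unbiased H K).

(* Main.v *)
Require Import Defs.
From mathcomp Require Import all_boot all_order all_algebra.
From mathcomp Require Import complex.
From mathcomp Require Import boolp classical_sets functions cardinality reals.
From mathcomp Require Import zify.

(** A parity separates the members of the family.  Attach to a vector over
    [{1, -1, 'i, - 'i}] the parity of the number of its entries [+-'i].  If [h]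
    and [k] are two such vectors of length [2 * n], their inner product is a
    Gaussian integer [a + 'i b]; its summands [h_j * (k_j)^*] are again fourth
    roots of unity, and [b] has the parity of the number of imaginary ones,
    that is, of the sum of the parities of [h] and [k].  Being unbiased means
    that [a ^+ 2 + b ^+ 2 = 2 * n], which is [2] modulo [4] when [n] is odd, so
    [b] is odd and [h] and [k] have different parities
    ([unbiased_row_parity]).  Hence the parity of the first row is an injection
    of a mutually unbiased family into a two-element set. *)

Set Implicit Arguments.
Unset Strict Implicit.
Unset Printing Implicit Defensive.

Import Order.TTheory GRing.Theory Num.Theory.
Local Open Scope ring_scope.
Local Open Scope sesquilinear_scope.

Section Parity.
Variable C : numClosedFieldType.
Implicit Types (x y : C) (a b : int).

(** On fourth roots of unity this bit singles out [+-'i]; writing it with a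
    square avoids distinguishing the two signs. *)
Definition imag_bit x : bool := x ^+ 2 != 1.

Definition row_parity m (H : 'M[C]_m) (i : 'I_m) : bool :=
  \big[addb/false]_(j < m) imag_bit (H i j).

Lemma imag_bit_mul_conj x y :
  x \in [:: 1; -1; 'i; - 'i] -> y \in [:: 1; -1; 'i; - 'i] ->
  imag_bit (x * y^*) = imag_bit x (+) imag_bit y.
Proof.
have N1 : (-1 == 1 :> C) = false by rewrite eq_sym -addr_eq0 (pnatr_eq0 C 2).
rewrite /imag_bit exprMn -rmorphXn /= => xU yU.
have sqr z : z \in [:: 1; -1; 'i; - 'i] -> z ^+ 2 = 1 \/ z ^+ 2 = -1 :> C.
  by rewrite !inE => /or4P[] /eqP ->; rewrite ?sqrrN ?expr1n ?sqrCi; auto.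
by case: (sqr x xU) => ->; case: (sqr y yU) => ->;
  rewrite ?rmorphN ?rmorph1 ?mulrNN ?mulr1 ?mul1r ?eqxx ?N1.
Qed.

Lemma mul_conj_fourth_root x y :
  x \in [:: 1; -1; 'i; - 'i] -> y \in [:: 1; -1; 'i; - 'i] ->
  x * y^* \in [:: 1; -1; 'i; - 'i].
Proof.
have ii : 'i * 'i = -1 :> C by rewrite -expr2 sqrCi.
rewrite !inE => /or4P[] /eqP -> /or4P[] /eqP ->;
  by rewrite ?rmorphN ?rmorph1 /= ?conjCi ?opprK ?mulrN ?mulNr ?mulr1 ?mul1r
    ?ii ?opprK ?eqxx /= ?orbT.
Qed.

Lemma fourth_root_gaussian x : x \in [:: 1; -1; 'i; - 'i] ->
  exists a b, x = a%:~R + 'i * b%:~R /\ odd `|b| = imag_bit x.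
Proof.
have N1 : (-1 == 1 :> C) = false by rewrite eq_sym -addr_eq0 (pnatr_eq0 C 2).
rewrite /imag_bit !inE => /or4P[] /eqP ->.
- by exists 1, 0; rewrite mulr0 addr0 expr1n eqxx.
- by exists (-1), 0; rewrite mulr0 addr0 mulrN1z sqrrN expr1n eqxx.
- by exists 0, 1; rewrite mulr1 add0r sqrCi N1.
- by exists 0, (-1); rewrite mulrN1z mulrN1 add0r sqrrN sqrCi N1.
Qed.

Lemma sum_fourth_roots_gaussian (I : finType) (u : I -> C) :
  (forall j, u j \in [:: 1; -1; 'i; - 'i]) ->
  exists a b, \sum_j u j = a%:~R + 'i * b%:~R
    /\ odd `|b| = \big[addb/false]_j imag_bit (u j).
Proof.
move=> uU.
elim/big_ind2: _ => [|z p w q [a [b [-> <-]]] [c [d [-> <-]]]|j _].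
- by exists 0, 0; rewrite mulr0 addr0.
- exists (a + c), (b + d); split; last by lia.
  by rewrite !rmorphD /= mulrDr addrACA.
- exact: fourth_root_gaussian.
Qed.

(** Squares are [0] or [1] modulo [4], so a sum of two squares that is [2]
    modulo [4] has both terms odd. *)
Lemma odd_of_sum_sqr a b (n : nat) : odd n ->
  a ^+ 2 + b ^+ 2 = (2 * n)%N -> odd `|b|.
Proof.
move=> n_odd; apply: contra_eqT => b_even.
have [c ->] : exists c : int, b = 2 * c by exists (b %/ 2)%Z; lia.
have [d [e [-> e01]]] : exists d e : int, a = 2 * d + e /\ (e = 0 \/ e = 1).
  by exists (a %/ 2)%Z, (a %% 2)%Z; lia.
apply/eqP; case: e01 => ->; rewrite !expr2; nia.
Qed.

Lemma unbiased_row_parity n (H K : 'M[C]_(2 * n)) (i j : 'I_(2 * n)) :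
  odd n -> (forall i j, H i j \in [:: 1; -1; 'i; - 'i]) ->
  (forall i j, K i j \in [:: 1; -1; 'i; - 'i]) ->
  unbiased H K -> row_parity H i (+) row_parity K j.
Proof.
move=> n_odd HU KU /(_ i j) /(congr1 (fun z => z ^+ 2)); rewrite sqrtCK mxE.
have [k|a [b [E bP]]] :=
    @sum_fourth_roots_gaussian _ (fun k => H i k * (K j k)^*).
  exact: mul_conj_fourth_root.
under eq_bigr do rewrite !mxE.
rewrite E normC2_rect ?realz // => ab.
rewrite /row_parity -big_split /=.
under eq_bigr do rewrite -imag_bit_mul_conj //.
rewrite -bP; apply: (@odd_of_sum_sqr a b n) => //.
by apply/eqP; rewrite -(eqr_int C) rmorphD !rmorphXn /= ab.
Qed.

End Parity.

Theorem theorem3 (R : realType) (n : nat) (n_odd : odd n)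
    (S : set 'M[R[i]%C]_(2 * n)) (S_mub : mutually_unbiased_hadamard S) :
  (S #<= `I_2)%card.
Proof.
have m_gt0 : (0 < 2 * n)%N by lia.
pose f (H : 'M[R[i]%C]_(2 * n)) : nat := row_parity H (Ordinal m_gt0).
case: S_mub => S_had S_unb.
apply/pcard_leP/injfunPex; exists f.
  by move=> H _ /=; rewrite /f; case: row_parity.
move=> H K /set_mem SH /set_mem SK fHK; apply: contrapT => /(S_unb _ _ SH SK).
move=> /(unbiased_row_parity (Ordinal m_gt0) (Ordinal m_gt0) n_odd
  (S_had _ SH).1 (S_had _ SK).1).
by move: fHK; rewrite /f; do 2 case: row_parity.
Qed.
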